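(* Let $q\in(-1,1)$ and $|q|<t<1$, let $n\ge1$ and $(x_1,\dots,x_n)\in H_{\mathbb R}^n$. Then $$\tilde\varphi\big(\mathrm Y_{q,t}(x_n)\cdots\mathrm Y_{q,t}(x_1)\big)=\sum_{\pi\in\mathcal P_{\ge2}(n)}q^{\mathrm{rc}(\pi)}\,t^{\mathrm{rarc}(\pi)}\prod_{B\in\pi}\Big\langle x_{\max(B)},\prod_{i\in B,\ i\ne\min(B),\max(B)}T_{x_i}\,x_{\min(B)}\Big\rangle,$$ where in each block $B=\{i_1<\dots<i_m\}$ the operator product is $T_{x_{i_{m-1}}}\cdots T_{x_{i_3}}T_{x_{i_2}}$ (the identity if $m=2$).
   Context: $H_{\mathbb R}$ is a separable real Hilbert space, $H$ its complexification, with inner product $\langle\cdot,\cdot\rangle$ linear in the right and antilinear in the left argument. $\mathcal F_{\rm fin}(H)=\bigoplus_{n\ge0}H^{\otimes n}$ is the algebraic full Fock space, $H^{\otimes0}=\mathbb C\Omega$ with $\|\Omega\|=1$. For $q\in(-1,1)$, $|q|<t<1$, let $\tilde P^{(n)}_{q,t}=t^{\binom n2}\sum_{\sigma\in S(n)}(q/t)^{|\sigma|}\sigma$ on $H^{\otimes n}$ for $n\ge1$ (where $|\sigma|$ is the number of inversions and $S(n)$ acts by permuting tensor factors), and $\tilde P^{(0)}_{q,t}=I$; convention $0^0=1$. The $(q,t)$-inner product is $$\langle x_1\otimes\cdots\otimes x_m,y_1\otimes\cdots\otimes y_n\rangle_{\widetilde{q,t}}=\langle x_1\otimes\cdots\otimes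 x_m,\tilde P^{(n)}_{q,t}(y_1\otimes\cdots\otimes y_n)\rangle_{0,0},$$ with $\langle x_1\otimes\cdots\otimes x_m,y_1\otimes\cdots\otimes y_n\rangle_{0,0}=\delta_{m,n}\prod_i\langle x_i,y_i\rangle$. The vacuum state is $\tilde\varphi(X)=\langle\Omega,X\Omega\rangle_{\widetilde{q,t}}$. Operators ($\check x_k$ means the factor is omitted; $n\ge1$): the annihilation operator $a_{q,t}(x)(x_1\otimes\cdots\otimes x_n)=\sum_{k=1}^nt^{k-1}q^{n-k}\langle x,x_k\rangle x_1\otimes\cdots\otimes\check x_k\otimes\cdots\otimes x_n$, $a_{q,t}(x)\Omega=0$; the creation operator (its adjoint for the $(q,t)$-inner product) $a^*_{q,t}(x)(x_1\otimes\cdots\otimes x_n)=x_1\otimes\cdots\otimes x_n\otimes x$, $a^*_{q,t}(x)\Omega=x$; for a bounded selfadjoint operator $T$ on $H$, the gauge operator $\tilde p(T)(x_1\otimes\cdots\otimes x_n)=\sum_{k=1}^nt^{k-1}q^{n-k}x_1\otimes\cdots\otimes\check x_k\otimes\cdots\otimes x_n\otimes T(x_k)$, $\tilde p(T)\Omega=0$. Fix bounded selfadjoint operators $T_x$ on $H$ indexed by $x\in H_{\mathbb R}$, and put $\mathrm Y_{q,t}(x)=a_{q,t}(x)+a^*_{q,t}(x)+\tilde p(T_x)$ for $x\in H_{\mathbb R}$. Combinatorics: $\mathcal P_{\ge2}(n)$ is the set of set partitions of $\{1,\dots,n\}$ without singleton blocks. An arc of $\pi$ is a pair $\{i,j\}$,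 $i<j$, of elements of one block such that $j$ is the smallest element of that block greater than $i$. $\mathrm{rc}(\pi)$ is the number of unordered pairs of arcs of $\pi$ which cross, i.e. can be written $\{i,j\},\{i',j'\}$ with $i<i'<j<j'$. $\mathrm{rarc}(\pi)$ is the number of unordered pairs of arcs of $\pi$ which are nested, i.e. can be written $\{i,j\},\{i',j'\}$ with $i<i'<j'<j$. *)

(* Defs.v *)
From HB Require Import structures.
From mathcomp Require Import all_boot all_order perm all_algebra complex.
From mathcomp Require Import all_classical all_reals all_analysis ring.
From mathcomp Require Import generic_quotient.
From mathcomp.multinomials Require Import freeg.

Set Implicit Arguments.
Unset Strict Implicit.
Unset Printing Implicit Defensive.

Import Order.TTheory GRing.Theory Num.Theory.
Import numFieldNormedType.Exports.

Local Open Scope ring_scope.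
Local Open Scope complex_scope.
Local Open Scope quotient_scope.

(* The tensor algebra of V, i.e. the direct sum over n of the algebraic tensor
   powers of V: the free K-vector space on words over V, modulo the relations
   saying that a word is linear in each of its letters.  The relations preserve
   the length of words, whence the grading; the empty word spans degree 0. *)
Section TensorAlgebra.
Variables (K : fieldType) (V : lmodType K).

Local Notation word := (seq V).
Local Notation freew := {freeg word / K}.

Definition multilinear (W : lmodType K) (f : word -> W) :=
  forall (s s' : word) (a : K) (u v : V),
    f (s ++ (a *: u + v) :: s') = a *: f (s ++ u :: s') + f (s ++ v :: s').

Definition tensor_rel (s s' : word) (a : K) (u v : V) : freew :=
  << s ++ (a *: u + v) :: s' >> -
    (a *: << s ++ u :: s' >> + << s ++ v :: s' >>).

Inductive tensor_null : freew -> Prop :=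
| TensorNull0 : tensor_null 0
| TensorNullD c s s' a u v x :
    tensor_null x -> tensor_null (c *: tensor_rel s s' a u v + x).

Definition tensor_nullp : {pred freew} := fun x => `[< tensor_null x >].

Fact tensor_nullB : zmod_closed tensor_nullp.
Proof.
have nullN x : tensor_null x -> tensor_null (- x).
  elim=> [|c s s' a u v {}x _ IH]; first by rewrite oppr0; constructor.
  by rewrite opprD -scaleNr; constructor.
split=> [|x y]; first by apply/asboolP; constructor.
move=> /asboolP Hx /asboolP/nullN; move: (- y) => {}y Hy; apply/asboolP.
elim: Hx => [|c s s' a u v {}x _ IH]; first by rewrite add0r.
by rewrite -addrA; constructor.
Qed.

HB.instance Definition _ :=
  GRing.isZmodClosed.Build freew tensor_nullp tensor_nullB.

Definition tensor_alg : Type := Quotient.quot tensor_nullp.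

HB.instance Definition _ := GRing.Zmodule.on tensor_alg.
HB.instance Definition _ := Quotient.on tensor_alg.

Lemma tensor_eqP (x y : freew) :
  \pi_(tensor_alg) x = \pi_(tensor_alg) y <-> tensor_null (x - y).
Proof.
have E := Quotient.idealrBE tensor_nullp x y.
split=> [e|/asboolP n].
  by apply/asboolP; change (x - y \in tensor_nullp); rewrite E; apply/eqP.
by apply/eqP; rewrite -E.
Qed.

Lemma tensor_nullZ c x : tensor_null x -> tensor_null (c *: x).
Proof.
elim=> [|c' s s' a u v {}x _ IH]; first by rewrite scaler0; constructor.
by rewrite scalerDr scalerA; constructor.
Qed.

Definition tensor_scale (c : K) (x : tensor_alg) : tensor_alg :=
  \pi_(tensor_alg) (c *: (repr x : freew)).

Lemma pi_tensorZ c (x : freew) :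
  \pi_(tensor_alg) (c *: x) = tensor_scale c (\pi_(tensor_alg) x).
Proof.
apply/tensor_eqP; rewrite -scalerBr; apply: tensor_nullZ.
by apply/tensor_eqP; rewrite reprK.
Qed.

Lemma pi_tensorD (x y : freew) :
  \pi_(tensor_alg) (x + y) = \pi_(tensor_alg) x + \pi_(tensor_alg) y.
Proof. by rewrite (@Quotient.pi_add _ (tensor_nullp : zmodClosed _) x y). Qed.

Lemma tensor_surj (x : tensor_alg) : exists r : freew, x = \pi_(tensor_alg) r.
Proof. by exists (repr x); rewrite reprK. Qed.

Fact tensor_scaleA a b x : tensor_scale a (tensor_scale b x) = tensor_scale (a * b) x.
Proof. by have [r ->] := tensor_surj x; rewrite -!pi_tensorZ scalerA. Qed.
Fact tensor_scale1 : left_id 1 tensor_scale.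
Proof. by move=> x; have [r ->] := tensor_surj x; rewrite -!pi_tensorZ scale1r. Qed.
Fact tensor_scaleDr : right_distributive tensor_scale +%R.
Proof.
move=> a x y; have [r ->] := tensor_surj x; have [r' ->] := tensor_surj y.
by rewrite -pi_tensorD -!pi_tensorZ scalerDr pi_tensorD.
Qed.
Fact tensor_scaleDl x : {morph tensor_scale^~ x : a b / a + b}.
Proof.
move=> a b; have [r ->] := tensor_surj x.
by rewrite -!pi_tensorZ scalerDl pi_tensorD.
Qed.

HB.instance Definition _ := GRing.Zmodule_isLmodule.Build K tensor_alg
  tensor_scaleA tensor_scale1 tensor_scaleDr tensor_scaleDl.

Lemma pi_tensor_linear c (x y : freew) :
  \pi_(tensor_alg) (c *: x + y) = c *: \pi_(tensor_alg) x + \pi_(tensor_alg) y.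
Proof. by rewrite pi_tensorD pi_tensorZ. Qed.

Definition tens (w : word) : tensor_alg := \pi_(tensor_alg) << w >>.

Lemma tens_multilinear : multilinear tens.
Proof.
move=> s s' a u v; rewrite /tens -pi_tensor_linear.
by apply/tensor_eqP; rewrite -[X in tensor_null X]addr0 -[X in X + _]scale1r; do 2 constructor.
Qed.

(* The linear map on the tensor algebra with prescribed values f on simple
   tensors; it is meaningful when f is multilinear, see [tensor_extE]. *)
Definition tensor_ext (W : lmodType K) (f : word -> W) (x : tensor_alg) : W :=
  fglift f (repr x : freew).

Section Extension.
Variables (W : lmodType K) (f : word -> W).

Lemma fglift_linear : linear (fglift f : freew -> W).
Proof.
have sub := lift_is_additive f.
have lift0 : fglift f 0 = 0 by rewrite -(subrr 0) sub subrr.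
have liftN x : fglift f (- x) = - fglift f x by rewrite -sub0r sub lift0 sub0r.
have liftD x y : fglift f (x + y) = fglift f x + fglift f y.
  by rewrite -{1}(opprK y) sub liftN opprK.
have liftZ c x : fglift f (c *: x) = c *: fglift f x.
  elim/freeg_rect_dom0: x => [|k w x _ _ IH].
    by rewrite scaler0 lift0 scaler0.
  rewrite scalerDr !liftD IH scalerDr; congr (_ + _).
  have -> : c *: << k *g w >> = << c * k *g w >> :> freew.
    by apply/eqP/freeg_eqP => z; rewrite coeffZ !coeffU mulrA.
  by rewrite !liftU scalerA.
by move=> c x y; rewrite liftD liftZ.
Qed.

Hypothesis mf : multilinear f.

Lemma fglift_null (x : freew) : tensor_null x -> fglift f x = 0.
Proof.
elim=> [|c s s' a u v {}x _ IH].
  by rewrite -(subrr 0) lift_is_additive subrr.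
rewrite fglift_linear IH addr0 /tensor_rel lift_is_additive fglift_linear.
by rewrite !liftU !scale1r mf subrr scaler0.
Qed.

Lemma tensor_ext_pi (x : freew) : tensor_ext f (\pi_(tensor_alg) x) = fglift f x.
Proof.
rewrite /tensor_ext; apply/eqP; rewrite -subr_eq0 -lift_is_additive.
by apply/eqP/fglift_null/tensor_eqP; rewrite reprK.
Qed.

Lemma tensor_extE (w : word) : tensor_ext f (tens w) = f w.
Proof. by rewrite tensor_ext_pi liftU scale1r. Qed.

Lemma tensor_ext_linear : linear (tensor_ext f).
Proof.
move=> c x y; have [r ->] := tensor_surj x; have [r' ->] := tensor_surj y.
by rewrite -pi_tensor_linear !tensor_ext_pi fglift_linear.
Qed.

End Extension.

End TensorAlgebra.

Definition separable (T : topologicalType) :=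
  exists D : set T, countable D /\ dense D.

(* A pair (a, b) stands for a + i b. *)
Definition cplx (V : Type) : Type := (V * V)%type.

Section Complexification.
Variables (R : rcfType) (V : lmodType R).

HB.instance Definition _ := GRing.Zmodule.copy (cplx V) (V * V)%type.

Definition cplx_scale (z : R[i]) (x : cplx V) : cplx V :=
  (complex.Re z *: x.1 - complex.Im z *: x.2,
   complex.Re z *: x.2 + complex.Im z *: x.1).

Fact cplx_scaleA a b x : cplx_scale a (cplx_scale b x) = cplx_scale (a * b) x.
Proof.
case: a b x => [a a'] [b b'] [x y]; congr (_, _) => /=.
  rewrite scalerBr scalerDr !scalerA scalerBl scalerDl !opprD.
  by rewrite [X in _ + X]addrC addrACA.
rewrite scalerBr scalerDr !scalerA scalerBl scalerDl.
by rewrite [X in _ + X]addrC addrACA.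
Qed.
Fact cplx_scale1 : left_id 1 cplx_scale.
Proof.
by move=> [x y]; rewrite /cplx_scale /= !scale1r !scale0r subr0 addr0.
Qed.
Fact cplx_scaleDr : right_distributive cplx_scale +%R.
Proof.
move=> a [x y] [x' y']; congr (_, _); rewrite /= !scalerDr ?opprD;
  exact: addrACA.
Qed.
Fact cplx_scaleDl x : {morph cplx_scale^~ x : a b / a + b}.
Proof.
move=> [a a'] [b b']; congr (_, _); rewrite /= !scalerDl ?opprD; exact: addrACA.
Qed.

HB.instance Definition _ := GRing.Zmodule_isLmodule.Build R[i] (cplx V)
  cplx_scaleA cplx_scale1 cplx_scaleDr cplx_scaleDl.

Definition of_real (x : V) : cplx V := (x, 0).

Variable ip : {dot V for idfun}.

(* <a + i b, c + i d>, antilinear in the left argument *)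
Definition cip (x y : cplx V) : R[i] :=
  (ip x.1 y.1 + ip x.2 y.2) +i* (ip x.1 y.2 - ip x.2 y.1).

Lemma cipC x y : (cip x y)^* = cip y x.
Proof.
have sym a b : ip a b = ip b a.
  by rewrite (hermitian_subproof a b) /= expr0 mul1r.
case: x y => [a b] [c d]; rewrite /cip /= opprB.
by rewrite (sym a c) (sym b d) (sym b c) (sym a d).
Qed.

Lemma cip_linear x : linear (cip x : cplx V -> R[i]^o).
Proof.
move=> [z z'] [c d] [c' d']; case: x => a b.
have linl (u v w : V) (k : R) : ip u (k *: v + w) = k * ip u v + ip u w.
  by rewrite linearP.
have linB (u v w : V) : ip u (v - w) = ip u v - ip u w by rewrite linearB.
have linD (u v w : V) : ip u (v + w) = ip u v + ip u w by rewrite linearD.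
have linZ (u v : V) (k : R) : ip u (k *: v) = k * ip u v by rewrite linearZ.
apply/eqP; rewrite /cip eq_complex /= !(linB, linD, linZ).
by apply/andP; split; apply/eqP; ring.
Qed.

Definition cnorm (x : cplx V) : R := Num.sqrt (complex.Re (cip x x)).

Definition bounded_op (T : cplx V -> cplx V) :=
  exists M : R, forall x, cnorm (T x) <= M * cnorm x.

Definition selfadjoint_op (T : cplx V -> cplx V) :=
  forall x y, cip (T x) y = cip x (T y).

End Complexification.

(* Words are indexed from 0: their letters are nth 0 w 0, ..., nth 0 w n.-1
   where n = size w. *)
Section Fock.
Variables (R : realType) (HR : completeNormedModType R) (ip : {dot HR for idfun}).
Variables q t : R.

Local Notation H := (cplx HR).

Local Notation fock := (tensor_alg (H : lmodType R[i])).

Definition vacuum : fock := tens [::].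

(* \sum_k t^{k-1} q^{n-k} phi(x_k, x_1 ... x_n with x_k omitted), for the letters
   numbered from 1 *)
Definition qt_sum (phi : H -> seq H -> fock) (w : seq H) : fock :=
  \sum_(k < size w) ((t ^+ k * q ^+ (size w - k.+1))%:C : R[i]) *:
     phi (nth 0 w k) (take k w ++ drop k.+1 w).

Lemma qt_sum_multilinear (phi : H -> seq H -> fock) :
    (forall w, linear (phi^~ w)) -> (forall y, multilinear (phi y)) ->
  multilinear (qt_sum phi).
Proof.
move=> lin1 lin2 s s' a u v; rewrite /qt_sum !size_cat /= scaler_sumr -big_split.
apply: eq_bigr => k _ /=; rewrite scalerA [a * _]mulrC -scalerA -scalerDr; congr (_ *: _).
rewrite !nth_cat !take_cat !drop_cat; case: (ltngtP k (size s)) => [ks|ks|->].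
- case: (ltngtP k.+1 (size s)) (ks) => // [_ _|-> _].
    by rewrite !catA lin2.
  by rewrite subnn !drop0 lin2.
- rewrite (ltnNge k.+1) (leqW (ltnW ks)) /=.
  have -> : (k.+1 - size s = (k - size s).+1)%N by rewrite subSn // ltnW.
  have : (0 < k - size s)%N by rewrite subn_gt0.
  by case: (k - size s)%N => //= m _; rewrite -!catA /= lin2.
- by rewrite subnn subSnn /= (ltnNge _.+1) leqnSn /= lin1.
Qed.

Definition annihilation (x : H) : fock -> fock :=
  tensor_ext (qt_sum (fun y w => cip ip x y *: tens w)).

Definition creation (x : H) : fock -> fock :=
  tensor_ext (fun w => tens (rcons w x)).

Definition gauge (T : H -> H) : fock -> fock :=
  tensor_ext (qt_sum (fun y w => tens (rcons w (T y)))).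

Lemma annihilationE x w : annihilation x (tens w) =
  qt_sum (fun y w => cip ip x y *: tens w) w.
Proof.
apply: tensor_extE; apply: qt_sum_multilinear => [w'|y].
  by move=> a u v; rewrite cip_linear scalerDl scalerA.
move=> s s' a u v.
by rewrite tens_multilinear scalerDr !scalerA [_ * a]mulrC.
Qed.

Lemma creationE x w : creation x (tens w) = tens (rcons w x).
Proof.
apply: (tensor_extE (f := fun w => tens (rcons w x))) => s s' a u v.
by rewrite !rcons_cat /= tens_multilinear.
Qed.

Lemma gaugeE (T : {linear H -> H}) w : gauge T (tens w) =
  qt_sum (fun y w => tens (rcons w (T y))) w.
Proof.
apply: tensor_extE; apply: qt_sum_multilinear => [w'|y].
  by move=> a u v; rewrite linearP -!cats1 tens_multilinear.
by move=> s s' a u v; rewrite !rcons_cat /= tens_multilinear.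
Qed.

Definition Yop (T : HR -> {linear H -> H}) (x : HR) (u : fock) : fock :=
  annihilation (of_real x) u + creation (of_real x) u + gauge (T x) u.

Definition inversions n (s : 'S_n) : nat :=
  #|[set p : 'I_n * 'I_n | (p.1 < p.2)%N && (s p.2 < s p.1)%N]|.

Definition perm_word (w : seq H) (s : 'S_(size w)) : seq H :=
  [seq nth 0 w (s i) | i <- enum 'I_(size w)].

(* On a word of length n; it is the identity in degree 0, where the sum is over
   the unique permutation of the empty set. *)
Definition symmetrizer_word (w : seq H) : fock :=
  ((t ^+ 'C(size w, 2))%:C : R[i]) *:
    \sum_(s : 'S_(size w)) (((q / t) ^+ inversions s)%:C : R[i]) *:
       tens (perm_word s).

Definition symmetrizer : fock -> fock := tensor_ext symmetrizer_word.

Lemma symmetrizerE w : symmetrizer (tens w) = symmetrizer_word w.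
Proof.
apply: tensor_extE => s s' a u v; rewrite /symmetrizer_word.
pose n := size (s ++ u :: s').
pose W (z : H) (p : 'S_n) := [seq nth 0 (s ++ z :: s') (p i) | i <- enum 'I_n].
suff key p : tens (W (a *: u + v) p) = a *: tens (W u p) + tens (W v p).
  have size_eq z : size (s ++ z :: s') = n by rewrite /n !size_cat.
  have E z : symmetrizer_word (s ++ z :: s') = (t ^+ 'C(n, 2))%:C *:
      \sum_(p : 'S_n) ((q / t) ^+ inversions p)%:C *: tens (W z p).
    by rewrite /symmetrizer_word /perm_word /W; case: _ / (size_eq z).
  rewrite -!/(symmetrizer_word _) !E scalerA [a * _]mulrC -scalerA -scalerDr.
  congr (_ *: _); rewrite scaler_sumr -big_split; apply: eq_bigr => p _ /=.
  by rewrite key scalerDr !scalerA [_ * a]mulrC.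
have szn : (size s < n)%N by rewrite /n size_cat /= -addSnnS leq_addr.
pose j : 'I_n := Ordinal szn; pose i0 := (p^-1)%g j.
rewrite /W; have : i0 \in enum 'I_n by rewrite mem_enum.
move: (enum 'I_n) (enum_uniq 'I_n) => l ul i0l; case/splitPr: i0l ul => e1 e2.
rewrite cat_uniq /= => /and4P[_ /norP[i0e1 _] i0e2 _].
have off z i : i != i0 ->
    nth 0 (s ++ z :: s') (p i) = nth 0 (s ++ u :: s') (p i).
  move=> ii0; rewrite !nth_cat; case: ltnP => // ge_i.
  have : (size s < p i)%N.
    rewrite ltn_neqAle ge_i andbT; apply: contra ii0 => /eqP e.
    by rewrite /i0 -(permK p i); apply/eqP; congr (_ _); apply: val_inj.
  by rewrite -subn_gt0; case: (p i - size s)%N.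
have E z : [seq nth 0 (s ++ z :: s') (p i) | i <- e1 ++ i0 :: e2] =
    [seq nth 0 (s ++ u :: s') (p i) | i <- e1] ++
    z :: [seq nth 0 (s ++ u :: s') (p i) | i <- e2].
  rewrite map_cat /= permKV nth_cat ltnn subnn /=; congr (_ ++ _ :: _).
    by apply/eq_in_map => i ie; apply: off; apply: contraNneq i0e1 => <-.
  by apply/eq_in_map => i ie; apply: off; apply: contraNneq i0e2 => <-.
by rewrite !E tens_multilinear.
Qed.

Definition word_ip (v w : seq H) : R[i] :=
  if size v == size w then \prod_(i < size v) cip ip (nth 0 v i) (nth 0 w i)
  else 0.

(* The extension of word_ip to the Fock space, linear in the right argument and
   antilinear in the left one; see [ip00_multilinear], [ip00_tens], [ip00_linear]. *)
Definition ip00 (u v : fock) : R[i] :=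
  (tensor_ext (W := R[i]^o) (fun w =>
     (tensor_ext (W := R[i]^o) (word_ip w) v : R[i])^*) u)^*.

Lemma word_ip_multilinear w : multilinear (W := R[i]^o) (word_ip w).
Proof.
move=> s s' a u v; rewrite /word_ip !size_cat /=.
case: eqP => [e|_]; last by rewrite scaler0 addr0.
have szs : (size s < size w)%N by rewrite e -addSnnS leq_addr.
have E z : \prod_(i < size w) cip ip (nth 0 w i) (nth 0 (s ++ z :: s') i) =
    cip ip (nth 0 w (size s)) z * \prod_(i < size w | i != Ordinal szs)
      cip ip (nth 0 w i) (nth 0 (s ++ u :: s') i).
  rewrite (bigD1 (Ordinal szs)) //= nth_cat ltnn subnn /=; congr (_ * _).
  apply: eq_bigr => i ii; rewrite !nth_cat; case: ltnP => // ge_i.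
  have : (size s < i)%N.
    rewrite ltn_neqAle ge_i andbT; apply: contra ii => /eqP ei.
    by apply/eqP/val_inj.
  by rewrite -subn_gt0; case: (i - size s)%N.
by rewrite !E cip_linear mulrDl scalerAl.
Qed.

Lemma word_ipC v w : (word_ip v w)^* = word_ip w v.
Proof.
rewrite /word_ip eq_sym; case: eqP => [e|_]; last exact: rmorph0.
by rewrite rmorph_prod e; apply: eq_bigr => i _; exact: cipC.
Qed.

Lemma ip00_tens v w : ip00 (tens v) (tens w) = word_ip v w.
Proof.
have right z : tensor_ext (W := R[i]^o) (word_ip z) (tens w) = word_ip z w.
  exact: (tensor_extE (word_ip_multilinear z)).
rewrite /ip00 (_ : (fun _ => _) = word_ip w).
  by rewrite (tensor_extE (word_ip_multilinear w)) word_ipC.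
by apply/funext => z; rewrite right word_ipC.
Qed.

Lemma ip00_multilinear v : multilinear (W := R[i]^o)
  (fun w => (tensor_ext (W := R[i]^o) (word_ip w) v : R[i])^*).
Proof.
move=> s s' a u u'; have [x ->] := tensor_surj v.
rewrite !(tensor_ext_pi (word_ip_multilinear _)).
have fg0 f : fglift (M := R[i]^o) f 0 = 0.
  by rewrite -(subrr 0) lift_is_additive subrr.
elim/freeg_rect_dom0: x => [|k w x _ _ IH].
  by rewrite !fg0 (rmorph0 conjc) scaler0 addr0.
pose g z := (fglift (M := R[i]^o) (word_ip z) x : R[i])^*.
have fgD z : (fglift (M := R[i]^o) (word_ip z) (<< k *g w >> + x) : R[i])^* =
    k^* * word_ip w z + g z.
  rewrite -[<< k *g w >>]scale1r fglift_linear liftU scale1r (rmorphD conjc).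
  by rewrite (rmorphM conjc) /= word_ipC.
have {}IH : g (s ++ (a *: u + u') :: s') = a * g (s ++ u :: s') + g (s ++ u' :: s').
  exact: IH.
have mw : word_ip w (s ++ (a *: u + u') :: s') =
    a * word_ip w (s ++ u :: s') + word_ip w (s ++ u' :: s').
  exact: word_ip_multilinear.
rewrite !fgD IH mw -[a *: _]/(a * _).
ring.
Qed.

Lemma ip00_linear u : linear (ip00 u : fock -> R[i]^o).
Proof.
have [x ->] := tensor_surj u; move=> a v v'.
rewrite /ip00 !(tensor_ext_pi (ip00_multilinear _)).
have fg0 f : fglift (M := R[i]^o) f 0 = 0.
  by rewrite -(subrr 0) lift_is_additive subrr.
elim/freeg_rect_dom0: x => [|k w x _ _ IH].
  by rewrite !fg0 (rmorph0 conjc) scaler0 addr0.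
pose g z := (fglift (M := R[i]^o)
  (fun w => (tensor_ext (W := R[i]^o) (word_ip w) z : R[i])^*) x : R[i])^*.
pose e z := tensor_ext (W := R[i]^o) (word_ip w) z : R[i].
have gD z : (fglift (M := R[i]^o)
    (fun w => (tensor_ext (W := R[i]^o) (word_ip w) z : R[i])^*)
    (<< k *g w >> + x) : R[i])^* = k^* * e z + g z.
  rewrite -[<< k *g w >>]scale1r fglift_linear liftU scale1r (rmorphD conjc).
  by rewrite (rmorphM conjc) /= conjcK.
have {}IH : g (a *: v + v') = a * g v + g v' by exact: IH.
have eD : e (a *: v + v') = a * e v + e v'.
  exact: (tensor_ext_linear (word_ip_multilinear w)).
rewrite !gD IH eD -[a *: _]/(a * _).
ring.
Qed.

Definition ipqt (u v : fock) : R[i] := ip00 u (symmetrizer v).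

Definition vacuum_state (X : fock -> fock) : R[i] := ipqt vacuum (X vacuum).

End Fock.

Section SetPartitions.
Variable n : nat.
Implicit Types (P : {set {set 'I_n}}) (a b : 'I_n * 'I_n).

Definition partition_ge2 P :=
  finset.partition P [set: 'I_n] && [forall B in P, (2 <= #|B|)%N].

Definition arcs P : {set 'I_n * 'I_n} :=
  [set a : 'I_n * 'I_n | (a.1 < a.2)%N &&
     [exists B in P, [&& a.1 \in B, a.2 \in B &
        [forall k in B, ~~ (a.1 < k < a.2)%N]]]].

(* For an unordered pair of arcs, at most one of the two orderings satisfies the
   condition, so that ordered pairs count unordered ones. *)
Definition rc P : nat :=
  #|[set ab in finset.setX (arcs P) (arcs P) |
      (ab.1.1 < ab.2.1)%N && (ab.2.1 < ab.1.2)%N && (ab.1.2 < ab.2.2)%N]|.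

Definition rarc P : nat :=
  #|[set ab in finset.setX (arcs P) (arcs P) |
      (ab.1.1 < ab.2.1)%N && (ab.2.1 < ab.2.2)%N && (ab.2.2 < ab.1.2)%N]|.

End SetPartitions.

(* For B = {i_1 < ... < i_m} (enum lists B increasingly, see [enum_block_sorted]):
   < x_{i_m}, T_{x_{i_{m-1}}} ... T_{x_{i_2}} x_{i_1} > *)
Definition block_weight (R : realType) (HR : completeNormedModType R)
    (ip : {dot HR for idfun}) (T : HR -> {linear cplx HR -> cplx HR}) (n : nat)
    (x : n.-tuple HR) (B : {set 'I_n}) : R[i] :=
  if [seq tnth x i | i <- enum B] is y :: s then
    cip ip (of_real (last y s))
      (foldl (fun v z => T z v) (of_real y) (behead (belast y s)))
  else 0.

Lemma enum_block_sorted n (B : {set 'I_n}) :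
  sorted ltn [seq val i | i <- enum B].
Proof.
rewrite {1}/enum_mem -enumT; apply: (@subseq_sorted _ _ ltn_trans _ (iota 0 n)).
  by rewrite -val_enum_ord map_subseq // filter_subseq.
exact: iota_ltn_sorted.
Qed.

(* Main.v *)
Require Import Defs.
From mathcomp Require Import all_boot all_order perm all_algebra complex.
From mathcomp Require Import all_classical all_reals all_analysis.
From mathcomp.multinomials Require Import freeg.
(* Sets and partitions below are those of finite types, so that their names have
   to shadow those of classical sets. *)
From mathcomp Require Import fintype finset.

Set Implicit Arguments.
Unset Strict Implicit.
Unset Printing Implicit Defensive.

Import Order.TTheory GRing.Theory Num.Theory.
Import numFieldNormedType.Exports.

(** The vacuum is acted on by the operators one after the other, and each
    product of operators is expanded as a sum of simple tensors. After k factors,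
    a term of the expansion is described by a partition P of the first k points,
    some of whose blocks are still open, that is, are to receive further points;
    an open block is represented by its largest element, and M is the set of
    these. The simple tensor of the term has one letter per open block, namely
    the vector T ... T x obtained by running through the block, and the letters
    come in the order of M: creation and gauge both append at the right the
    letter of the block which has just received the current point.

    The next factor Y(x_m) acts by opening the block {m} (creation), by adding m
    to an open block and leaving it open (gauge), or by adding m to an open block
    and closing it (annihilation). In the last two cases, the last point c of the
    chosen block is the source of a new arc (c, m). The letters to the left of
    the chosen one, each of which contributes a factor t, are the open points
    i < c; as they are still open after m, their future arcs will enclose (c, m).
    Those to the right, each contributing q, are the open points i with
    c < i < m, and their future arcs will cross (c, m). So a nesting or a
    crossing is paid for exactly when the first of its two arcs ends. The counts
    [nestings] and [crossings] follow this bookkeeping by regarding an open point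
    as an arc that ends at infinity, so that turning an open point into the
    source of an arc ending at m creates only the pairs just described
    ([overtakes_step]).

    Removing the largest point inverts this evolution, so that the terms at time
    m+1 are parametrised by a term at time m and a choice at m ([big_step]).
    This gives the expansion [foldl_Yop_vacuum] by induction. The (q,t)-inner
    product with the vacuum keeps only the empty word ([ipqt_vacuum_comb]), hence
    the terms without open block, and these are the partitions whose blocks all
    have at least two elements ([open_partition_ge2]). *)

(** * Gluing a new largest point to a block *)

Lemma setD1_id (T : finType) (x : T) (A : {set T}) : x \notin A -> A :\ x = A.
Proof. by move=> xA; apply/setDidPl; rewrite disjoint_sym disjoints1. Qed.

Lemma pblock_notin (T : finType) (P : {set {set T}}) (x : T) :
  pblock P x \notin P -> pblock P x = set0.
Proof. by rewrite /pblock; case: pickP => // B /andP[->]. Qed.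

Section OpenPartitions.
Variable n : nat.
Local Notation config := ({set {set 'I_n}} * {set 'I_n})%type.
Implicit Types (m c i j : 'I_n) (B M : {set 'I_n}) (P : {set {set 'I_n}}).

Definition below k : {set 'I_n} := [set i : 'I_n | (i < k)%N].

Lemma in_below k i : (i \in below k) = (i < k)%N.
Proof. by rewrite inE. Qed.

Lemma belowS m : below m.+1 = m |: below m.
Proof. by apply/setP => i; rewrite !inE -val_eqE /= ltnS leq_eqVlt. Qed.

(** Words are read off from enumerations, so a new largest point acts by
    appending a letter at the right. *)
Lemma enum_setU1_max m B :
  B \subset below m -> enum (m |: B) = rcons (enum B) m.
Proof.
move=> /subsetP Bm; apply: (inj_map val_inj).
apply: (irr_sorted_eq ltn_trans ltnn) => [||k].
- exact: enum_block_sorted.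
- rewrite map_rcons (sorted_pairwise ltn_trans) pairwise_rcons.
  rewrite -(sorted_pairwise ltn_trans) enum_block_sorted andbT.
  by rewrite all_map; apply/allP => i; rewrite mem_enum => /Bm; rewrite in_below.
- apply: eq_mem_map => i.
  by rewrite mem_rcons in_cons !mem_enum !inE.
Qed.

Lemma enum_setD1 B i : enum (B :\ i) = [seq j <- enum B | j != i].
Proof.
by rewrite {1 2}/enum_mem -filter_predI; apply: eq_filter => j; rewrite /= !inE.
Qed.

Lemma last_enum m c B :
  c \in B -> {in B, forall j, j <= c}%N -> last m (enum B) = c.
Proof.
move=> cB Bc; rewrite -(setD1K cB) enum_setU1_max ?last_rcons //.
apply/subsetP => j; rewrite !inE => /andP[jc /Bc].
by rewrite leq_eqVlt val_eqE (negPf jc).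
Qed.

Lemma last_enum_in m B : B != set0 ->
  last m (enum B) \in B /\ {in B, forall j, j <= last m (enum B)}%N.
Proof.
case/set0Pn => i iB; have [c cB cmax] := @arg_maxnP _ i (mem B) val iB.
by rewrite (last_enum _ cB cmax).
Qed.

(** When c = m lies outside the sets of P, its block is empty and {m} becomes a
    new block: the choice c = m thus encodes creation. *)
Definition glue m c P := (m |: pblock P c) |: P :\ pblock P c.

(** Removing the empty set accounts for the case where m was alone. *)
Definition unglue m P :=
  ((pblock P m :\ m) |: P :\ pblock P m) :\ set0.

(** The predecessor of a largest point m in its block; the default value m is
    the encoding of creation in [glue]. *)
Definition arc_source m P := last m (enum (pblock P m :\ m)).

Lemma pblock_out P k m : partition P (below k) -> (k <= m)%N -> pblock P m = set0.
Proof.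
move=> Pk km; apply/eqP; apply: contraTT km => /set0Pn[j].
rewrite /pblock; case: pickP => [B /andP[BP mB] _|_]; last by rewrite inE.
by move/subsetP: (partitionS Pk BP) => /(_ _ mB); rewrite in_below -ltnNge.
Qed.

Lemma pblock_subset P D c : partition P D -> pblock P c \subset D.
Proof.
move=> PD; rewrite /pblock; case: pickP => [B /andP[BP _]|_]; last exact: sub0set.
exact: partitionS PD BP.
Qed.

Lemma glue_partition m c P : partition P (below m) -> partition (glue m c P) (below m.+1).
Proof.
move=> Pm; have Bm := pblock_subset c Pm.
have mB : m \notin below m by rewrite in_below ltnn.
have PD : partition (P :\ pblock P c) (below m :\: pblock P c).
  have [BP|BP] := boolP (pblock P c \in P); first exact: partitionD1.
  by rewrite (pblock_notin BP) setD0 setD1_id // (partition0 Pm).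
rewrite /glue belowS.
have -> : m |: below m = (m |: pblock P c) :|: (below m :\: pblock P c).
  apply/setP => i; rewrite 3!in_setU in_setD -orbA; congr (_ || _).
  by case iB: (i \in pblock P c) => //=; rewrite (subsetP Bm).
apply: partitionU1 => //; first by apply/set0Pn; exists m; rewrite setU11.
rewrite -setI_eq0; apply/eqP/setP => i; rewrite !inE.
by have [->|_] := eqVneq i m; rewrite ?ltnn ?andbF //=; case: (i \in pblock P c).
Qed.

Lemma pblock_glue m c P : partition P (below m) -> pblock (glue m c P) m = m |: pblock P c.
Proof.
move=> /glue_partition /partition_trivIset ti.
by apply: (def_pblock (ti c)); rewrite setU11.
Qed.

Lemma pblock_glue_out m c P i : partition P (below m) ->
  i != m -> i \notin pblock P c -> pblock (glue m c P) i = pblock P i.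
Proof.
move=> Pm im ic; have Gm := glue_partition c Pm.
have [lim|lim] := ltnP i m; last first.
  have mi : (m < i)%N by rewrite ltn_neqAle eq_sym im.
  by rewrite (pblock_out Pm lim) (pblock_out Gm mi).
have iP : i \in cover P by rewrite (cover_partition Pm) in_below.
apply: (def_pblock (partition_trivIset Gm)); last by rewrite mem_pblock.
rewrite !inE pblock_mem // andbT; apply/orP; right.
by apply: contraNneq ic => <-; rewrite mem_pblock.
Qed.

Lemma glueK m c P : partition P (below m) -> unglue m (glue m c P) = P.
Proof.
move=> Pm; rewrite /unglue (pblock_glue c Pm).
have mP B : B \in P -> m \notin B.
  by move=> /(partitionS Pm)/subsetP Bm; apply/negP => /Bm; rewrite in_below ltnn.
have mB : m \notin pblock P c.
  by apply/negP => /(subsetP (pblock_subset c Pm)); rewrite in_below ltnn.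
rewrite setU1K //.
have -> : glue m c P :\ (m |: pblock P c) = P :\ pblock P c.
  rewrite /glue setU1K // !inE negb_and; apply/orP; right.
  by apply/negP => /mP; rewrite setU11.
have [BP|BP] := boolP (pblock P c \in P).
  by rewrite setD1K // setD1_id // (partition0 Pm).
by rewrite (pblock_notin BP) setU1K ?inE ?eqxx // setD1_id // (partition0 Pm).
Qed.

(** * Partitions with open blocks, and their growth *)

(** The states reached after k operators: the second component is the set of the
    largest points of the open blocks. A block can be closed only by a point
    that it receives later than its first, whence the last condition. *)
Definition open_partition k (s : config) :=
  [&& partition s.1 (below k), s.2 \subset below k,
      [forall i in s.2, forall j in pblock s.1 i, (j <= i)%N] &
      [forall B in s.1, (2 <= #|B|)%N || ~~ [disjoint B & s.2]]].

Lemma open_partitionP k P M : reflect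
  [/\ partition P (below k), M \subset below k,
      {in M, forall i, {in pblock P i, forall j, j <= i}%N} &
      {in P, forall B, (2 <= #|B|)%N || ~~ [disjoint B & M]}]
  (open_partition k (P, M)).
Proof.
apply: (iffP and4P) => /= -[Pk Mk H1 H2]; split=> //.
- move=> i iM j ji; move/forall_inP: H1 => /(_ i iM)/forall_inP; exact.
- by move=> B BP; move/forall_inP: H2; apply.
- by apply/forall_inP => i iM; apply/forall_inP => j; apply: H1.
- by apply/forall_inP => B; apply: H2.
Qed.

(** A choice (c, b) at time m: c tells which block receives m, as in [glue], and
    b whether that block is open afterwards. A block just created is open. *)
Definition valid_choice m M (e : 'I_n * bool) :=
  if e.1 == m then e.2 else e.1 \in M.

Definition step m (s : config) (e : 'I_n * bool) :=
  (glue m e.1 s.1, if e.2 then m |: s.2 :\ e.1 else s.2 :\ e.1).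

(** When m was created, c = m was not an open point before; the outer removal of
    m discards it. *)
Definition unstep m (s : config) :=
  let c := arc_source m s.1 in
  ((unglue m s.1, (c |: s.2 :\ m) :\ m), (c, m \in s.2)).

Section Step.
Variables (m c : 'I_n) (b : bool) (P : {set {set 'I_n}}) (M : {set 'I_n}).
Hypotheses (Ps : open_partition m (P, M)) (cb : valid_choice m M (c, b)).

Lemma choice_le : (c <= m)%N.
Proof.
have [_ /subsetP Mm _ _] := open_partitionP _ _ _ Ps.
move: cb; rewrite /valid_choice /=; case: eqVneq => [-> //|_ /Mm].
by rewrite in_below => /ltnW.
Qed.

Lemma choice_lt : (c < m)%N = (c != m).
Proof. by rewrite ltn_neqAle choice_le andbT. Qed.

Lemma max_choice : {in pblock P c, forall j, j <= c}%N.
Proof.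
have [Pm _ Mmax _] := open_partitionP _ _ _ Ps.
move: cb; rewrite /valid_choice /=; case: eqVneq => [-> _|_ /Mmax //].
by move=> j; rewrite (pblock_out Pm) ?inE.
Qed.

Lemma choice_pblock : (c \in pblock P c) = (c < m)%N.
Proof.
have [Pm _ _ _] := open_partitionP _ _ _ Ps.
by rewrite mem_pblock (cover_partition Pm) in_below.
Qed.

Lemma m_notin_M : m \notin M.
Proof.
have [_ /subsetP Mm _ _] := open_partitionP _ _ _ Ps.
by apply/negP => /Mm; rewrite in_below ltnn.
Qed.

Lemma m_notin_block B : B \in P -> m \notin B.
Proof.
have [Pm _ _ _] := open_partitionP _ _ _ Ps.
by move=> /(partitionS Pm)/subsetP Bm; apply/negP => /Bm; rewrite in_below ltnn.
Qed.

(** An open block contains a single open point, its largest element. *)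
Lemma open_notin_block i : i \in M :\ c -> i \notin pblock P c.
Proof.
have [Pm /subsetP Mm Mmax _] := open_partitionP _ _ _ Ps.
rewrite !inE => /andP[ic iM]; apply/negP => iB.
have cB : c \in pblock P c.
  by rewrite choice_pblock ltnNge; apply/negP => mc; rewrite (pblock_out Pm mc) inE in iB.
have E := same_pblock (partition_trivIset Pm) iB.
have ci : (c <= i)%N by apply: Mmax => //; rewrite E.
by move/negP: ic; apply; rewrite -val_eqE eqn_leq ci max_choice.
Qed.

Lemma pblock_step_open i : i \in M :\ c -> pblock (glue m c P) i = pblock P i.
Proof.
have [Pm _ _ _] := open_partitionP _ _ _ Ps.
move=> iMc; apply: pblock_glue_out => //; last exact: open_notin_block.
by apply: contraTneq iMc => ->; rewrite !inE (negPf m_notin_M) andbF.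
Qed.

Lemma step_open_partition : open_partition m.+1 (step m (P, M) (c, b)).
Proof.
have [Pm Mm Mmax Mcl] := open_partitionP _ _ _ Ps.
have mm : m \in below m.+1 by rewrite in_below.
have McS : M :\ c \subset below m.+1.
  by rewrite belowS; apply: (subset_trans (subD1set _ _)); apply: (subset_trans Mm); apply: subsetUr.
apply/open_partitionP; split=> /=.
- exact: glue_partition.
- by case: b; rewrite // subUset sub1set mm.
- move=> i iM' j jB.
  have: i \in m |: M :\ c by case: b iM' => // iM'; apply/setU1P; right.
  case/setU1P => [im|iMc].
    by move/subsetP: (pblock_subset i (glue_partition c Pm)) => /(_ j jB); rewrite in_below im ltnS.
  by move: jB; rewrite pblock_step_open // => jB; apply: Mmax jB; case/setD1P: iMc.
- move=> B /setU1P[->|/setD1P[Bc BP]].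
    have [cm|cm] := eqVneq c m; last first.
      rewrite cardsU1 (_ : m \notin _ = true) ?add1n ?ltnS.
        by rewrite card_gt0; apply/orP; left; apply/set0Pn; exists c; rewrite choice_pblock choice_lt.
      by apply/negP => /(subsetP (pblock_subset c Pm)); rewrite in_below ltnn.
    move: cb; rewrite /valid_choice /= cm eqxx => ->; apply/orP; right.
    by apply/pred0Pn; exists m; rewrite /= !setU11.
  have /orP[->//|/pred0Pn[j /andP[/= jB jM]]] := Mcl B BP.
  apply/orP; right; apply/pred0Pn; exists j; rewrite /= jB /=.
  have jMc : j \in M :\ c.
    rewrite !inE jM andbT; apply: contraNneq Bc => <-.
    by rewrite (def_pblock (partition_trivIset Pm) BP jB).
  by case: b; rewrite ?(in_setU1, jMc) ?orbT.
Qed.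

Lemma arc_source_glue : arc_source m (glue m c P) = c.
Proof.
have [Pm _ _ _] := open_partitionP _ _ _ Ps.
rewrite /arc_source pblock_glue // setU1K; last first.
  by apply/negP => /(subsetP (pblock_subset c Pm)); rewrite in_below ltnn.
case: (ltnP c m) => cm.
  by apply: last_enum max_choice; rewrite choice_pblock.
by rewrite (pblock_out Pm cm) enum_set0 /=; apply/val_inj/eqP; rewrite eqn_leq cm choice_le.
Qed.

Lemma stepK : unstep m (step m (P, M) (c, b)) = ((P, M), (c, b)).
Proof.
have [Pm Mm Mmax Mcl] := open_partitionP _ _ _ Ps.
rewrite /unstep /step /= arc_source_glue glueK //.
have mM := m_notin_M; have mMc : m \notin M :\ c by rewrite !inE (negPf mM) andbF.
have -> : (m \in (if b then m |: M :\ c else M :\ c)) = b.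
  by case: b; rewrite ?setU11 // (negPf mMc).
have -> : (if b then m |: M :\ c else M :\ c) :\ m = M :\ c.
  by case: b; rewrite ?setU1K // setD1_id.
congr (_, _, _); move: cb; rewrite /valid_choice /=; case: (eqVneq c m) => [-> _|_ cM].
  by rewrite (setD1_id mM) setU1K.
by rewrite setD1K // setD1_id.
Qed.

End Step.

Section Unstep.
Variables (m : 'I_n) (P : {set {set 'I_n}}) (M : {set 'I_n}).
Hypothesis Ps : open_partition m.+1 (P, M).
Let c := arc_source m P.
Let C := pblock P m.

(** The point m is the largest of all, and the source of its arc is the largest
    of the other elements of its block. *)
Lemma unstep_facts : [/\ m \in C, C \in P, {in C :\ m, forall j, j < m}%N &
  (if C :\ m == set0 then c = m else
   [/\ (c < m)%N, c \in C & {in C :\ m, forall j, j <= c}%N])].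
Proof.
have [Pm _ _ _] := open_partitionP _ _ _ Ps.
have mcov : m \in cover P by rewrite (cover_partition Pm) in_below.
have Cm : {in C :\ m, forall j, j < m}%N.
  move=> j /setD1P[jm /(subsetP (pblock_subset m Pm))].
  by rewrite in_below ltnS leq_eqVlt val_eqE (negPf jm).
split; rewrite ?mem_pblock ?pblock_mem //.
case: eqVneq => [C0|/(last_enum_in m)[cC cmax]].
  by rewrite /c /arc_source -/C C0 enum_set0.
by split=> //; [exact: Cm cC|case/setD1P: cC].
Qed.

Lemma unglue_partition : partition (unglue m P) (below m).
Proof.
have [Pm _ _ _] := open_partitionP _ _ _ Ps; have [mC CP _ _] := unstep_facts.
have PD := partitionD1 Pm CP.
have Csub := subsetP (partitionS Pm CP).
rewrite /unglue -/C; have [C0|C0] := eqVneq (C :\ m) set0.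
  rewrite C0 setU1K ?(partition0 PD) //.
  have -> : below m = below m.+1 :\: C; last by [].
  apply/setP => i; rewrite belowS !inE.
  move/setP: C0 => /(_ i); rewrite !inE; case: eqVneq => [->|_] /= C0.
    by rewrite mC ltnn.
  by rewrite C0.
have -> : below m = (C :\ m) :|: (below m.+1 :\: C).
  apply/setP => i; move: (Csub i); rewrite belowS !inE; case: eqVneq => [->|_] /=.
    by rewrite mC ltnn.
  by case: (i \in C) => //= ->.
rewrite setD1_id.
  apply: partitionU1 => //; rewrite -setI_eq0; apply/eqP/setP => i; rewrite !inE.
  by case: (i \in C); rewrite ?andbF.
by rewrite !inE negb_or eq_sym C0 (partition0 Pm) andbF.
Qed.

Lemma pblock_unglue : pblock (unglue m P) c = C :\ m.
Proof.
have Um := unglue_partition; have [mC CP _ H] := unstep_facts.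
case: ifP H => [/eqP C0 ->|C0 [cm cC _]].
  by rewrite C0; apply: pblock_out Um (leqnn _).
apply: (def_pblock (partition_trivIset Um)); last by rewrite !inE cC -val_eqE neq_ltn cm.
by rewrite /unglue !inE C0 eqxx.
Qed.

Lemma block_unglue B : (B \in unglue m P) = (B != set0) && ((B == C :\ m) || (B != C) && (B \in P)).
Proof. by rewrite /unglue !inE. Qed.

Lemma pblock_unglue_out i : i \in M :\ m -> pblock (unglue m P) i = pblock P i.
Proof.
have [Pm /subsetP Mm Mmax _] := open_partitionP _ _ _ Ps; have [mC CP _ _] := unstep_facts.
case/setD1P => im iM.
have iP : i \in cover P by rewrite (cover_partition Pm) Mm.
have im' : (i < m)%N by move: (Mm _ iM); rewrite in_below ltnS leq_eqVlt val_eqE (negPf im).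
apply: (def_pblock (partition_trivIset unglue_partition)); last by rewrite mem_pblock.
rewrite block_unglue pblock_mem // andbT; apply/andP; split.
  by apply/set0Pn; exists i; rewrite mem_pblock.
apply/orP; right; apply/negP => /eqP E.
by have := Mmax i iM m; rewrite E mC leqNgt im' => /(_ isT).
Qed.

(** An open point is the last of its block so far, which the source of an arc
    is not. *)
Lemma source_closed : c \notin M :\ m.
Proof.
have [Pm _ Mmax _] := open_partitionP _ _ _ Ps; have [mC CP Cm H] := unstep_facts.
apply/setD1P => -[cm cM]; case: ifP H => [_ cm'|_ [cltm cC _]].
  by rewrite cm' eqxx in cm.
have := Mmax c cM m; rewrite (same_pblock (partition_trivIset Pm) cC) mC leqNgt cltm.
by move/(_ isT).
Qed.

(** A block that loses m becomes open again through its new last point c, so the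
    condition on closed blocks survives; when m was alone, its block had one
    element and must have been open, as a created block is. *)
Lemma unstep_valid : let: (s, e) := unstep m (P, M) in
  open_partition m s && valid_choice m s.2 e.
Proof.
have [Pm /subsetP Mm Mmax Mcl] := open_partitionP _ _ _ Ps.
have [mC CP Cm H] := unstep_facts; have Um := unglue_partition.
rewrite /unstep /= -/c; apply/andP; split; last first.
  rewrite /valid_choice /=; case: (eqVneq c m) => [cm|cm]; last by rewrite !inE cm eqxx.
  move: H; case: ifP => [/eqP C0 _|_ []]; last by rewrite cm ltnn.
  have /orP[] := Mcl C CP.
    by rewrite (cardsD1 m) C0 cards0 addn0 leqNgt ltnS leq_b1.
  case/pred0Pn => j /andP[/= jC jM].
  have [<- //|jm] := eqVneq j m.
  by have : j \in C :\ m; [rewrite !inE jm jC | rewrite C0 inE].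
apply/open_partitionP; split=> //.
- apply/subsetP => i /setD1P[im /setU1P[ic|/setD1P[_ /Mm]]]; rewrite !in_below.
    by move: H; case: ifP => [_|_ []]; rewrite -ic // => E; rewrite E eqxx in im.
  by rewrite ltnS leq_eqVlt val_eqE (negPf im).
- move=> i /setD1P[im /setU1P[->|iM]] j; last first.
    by rewrite pblock_unglue_out //; apply: Mmax; case/setD1P: iM.
  rewrite pblock_unglue; move: H; case: ifP => [/eqP->|_ [_ _ H]]; first by rewrite inE.
  exact: H.
- move=> B; rewrite block_unglue => /andP[B0 /orP[/eqP BC|/andP[BC BP]]].
    move: H; rewrite -BC (negPf B0) => -[cm cC _]; apply/orP; right.
    apply/pred0Pn; exists c; rewrite /= BC !inE cC eqxx -val_eqE /=.
    by rewrite neq_ltn cm.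
  have /orP[->//|/pred0Pn[j /andP[/= jB jM]]] := Mcl B BP.
  apply/orP; right; apply/pred0Pn; exists j; rewrite /= jB !inE jM.
  have -> : j != m; last by rewrite orbT.
  apply: contraNneq BC => jm.
  by rewrite /C -jm (def_pblock (partition_trivIset Pm) BP jB).
Qed.

Lemma unstepK : step m (unstep m (P, M)).1 (unstep m (P, M)).2 = (P, M).
Proof.
have [Pm /subsetP Mm Mmax Mcl] := open_partitionP _ _ _ Ps.
have [mC CP Cm H] := unstep_facts.
rewrite /unstep /step /= -/c; congr (_, _).
  rewrite /glue pblock_unglue (setD1K mC) /unglue -/C.
  have CP0 : set0 \notin P :\ C by rewrite !inE (partition0 Pm) andbF.
  have -> : ((C :\ m |: P :\ C) :\ set0) :\ (C :\ m) = P :\ C.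
    have [->|C0] := eqVneq (C :\ m) set0.
      by rewrite !setU1K // setD1_id.
    have CmP : C :\ m \notin P.
      have /set0Pn[j jC] := C0; apply/negP => CmP.
      have := def_pblock (partition_trivIset Pm) CmP jC.
      rewrite (@def_pblock _ P C) ?(partition_trivIset Pm) //; last by case/setD1P: jC.
      by move=> E; move: mC; rewrite E !inE eqxx.
    have CmPC : C :\ m \notin P :\ C by rewrite in_setD1 (negPf CmP) andbF.
    have C0P : set0 \notin C :\ m |: P :\ C by rewrite in_setU1 negb_or eq_sym C0.
    by rewrite (setD1_id C0P) setU1K.
  by rewrite setD1K.
have -> : ((c |: M :\ m) :\ m) :\ c = M :\ m.
  have cM := source_closed.
  apply/setP => i; rewrite !inE; case: (eqVneq i c) => [->|_] /=.
    by move: cM; rewrite !inE => /negPf->.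
  by rewrite andbA andbb.
by case: ifP => mM; rewrite ?setD1K // setD1_id ?mM.
Qed.

End Unstep.

(** Every state at time m+1 arises from exactly one state at time m and one
    choice there. *)
Lemma big_step (V : nmodType) m (F : _ -> V) :
  (\sum_(s | open_partition m.+1 s) F s =
   \sum_(s | open_partition m s)
     \sum_(e | valid_choice m s.2 e) F (step m s e))%R.
Proof.
rewrite (reindex_onto (fun p => step m p.1 p.2) (unstep m)) /=; last first.
  by move=> [P M] /unstepK.
rewrite pair_big_dep /=; apply: eq_bigl => -[[P M] [c b]] /=.
apply/andP/andP => [[s_ok /eqP E]|[s_ok e_ok]].
  by have := unstep_valid s_ok; rewrite -[(_, if _ then _ else _)]/(step m (P, M) (c, b)) E => /andP.
by rewrite stepK ?step_open_partition.
Qed.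

(** * Counting crossings and nestings as the partition grows *)

Lemma arcsP P (a : 'I_n * 'I_n) : reflect
  ((a.1 < a.2)%N /\ exists B, [/\ B \in P, a.1 \in B, a.2 \in B &
     {in B, forall k : 'I_n, ~~ (a.1 < k < a.2)%N}])
  (a \in arcs P).
Proof.
rewrite inE; apply: (iffP andP) => -[a12].
  case/exists_inP => B BP /and3P[a1 a2 /forall_inP H].
  by split=> //; exists B.
case=> B [BP a1 a2 H]; split=> //; apply/exists_inP; exists B => //.
by rewrite a1 a2; apply/forall_inP.
Qed.

Lemma arcs_below k P a : partition P (below k) -> a \in arcs P -> (a.1 < a.2 < k)%N.
Proof.
move=> Pk /arcsP[-> [B [BP _ aB _]]].
by move/subsetP: (partitionS Pk BP) => /(_ _ aB); rewrite in_below.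
Qed.

(** The new point lies beyond all others, so it separates no two points of a
    block, and its only arc comes from the largest element of the block that it joins. *)
Lemma arcs_glue m c b P M :
    open_partition m (P, M) -> valid_choice m M (c, b) ->
  arcs (glue m c P) = if (c < m)%N then (c, m) |: arcs P else arcs P.
Proof.
move=> Ps cb; have [Pm Mm Mmax _] := open_partitionP _ _ _ Ps.
have cmax := max_choice Ps cb; have cB := choice_pblock c Ps.
have mB B : B \in P -> m \notin B by exact: (m_notin_block Ps).
have Bm j : j \in pblock P c -> (j < m)%N.
  by move/(subsetP (pblock_subset c Pm)); rewrite in_below.
have Gm := glue_partition c Pm.
suff H a : (a \in arcs (glue m c P)) = (c < m)%N && (a == (c, m)) || (a \in arcs P).
  by apply/setP => a; rewrite H; case: ifP => // _; rewrite !inE.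
apply/idP/orP.
  move=> /arcsP[a12 [B [/setU1P[BE|/setD1P[_ BP]] a1 a2 H]]]; last first.
    by right; apply/arcsP; split=> //; exists B.
  move: a1 a2; rewrite BE !in_setU1.
  have [a1m|_ /= a1] := eqVneq a.1 m.
    move=> _ /orP[/eqP a2m|/Bm]; first by rewrite a1m a2m ltnn in a12.
    by rewrite ltnNge -a1m (ltnW a12).
  have cm : (c < m)%N.
    rewrite -cB mem_pblock; move: a1; rewrite /pblock; case: pickP => [D|_]; last by rewrite inE.
    by case/andP => DP cD _; apply/bigcupP; exists D.
  have [a2m _|_ /= a2] := eqVneq a.2 m.
    left; rewrite cm -pair_eqE /= a2m eqxx andbT -val_eqE eqn_leq cmax //=.
    have := H c; rewrite BE in_setU1 cB cm orbT a2m cm andbT => /(_ isT).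
    by rewrite -leqNgt.
  right; apply/arcsP; split=> //; exists (pblock P c); split=> //.
    by apply: pblock_mem; rewrite -mem_pblock cB.
  by move=> k kB; apply: H; rewrite BE in_setU1 kB orbT.
case=> [/andP[cm /eqP->]|/arcsP[a12 [B [BP a1 a2 H]]]].
  apply/arcsP; split=> //=; exists (m |: pblock P c).
  rewrite !in_setU1 !eqxx cB cm orbT; split=> // k /setU1P[->|/cmax kc].
    by rewrite ltnn andbF.
  by rewrite ltnNge kc.
apply/arcsP; split=> //.
have [BE|Bc] := eqVneq B (pblock P c).
  exists (m |: pblock P c); rewrite !in_setU1 eqxx -BE a1 a2 !orbT; split=> // k.
  case/setU1P => [->|]; last exact: H.
  rewrite BE in a2.
  by rewrite [(m < _)%N]ltnNge (ltnW (Bm _ a2)) andbF.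
by exists B; split=> //; rewrite in_setU1 in_setD1 Bc BP orbT.
Qed.

Section Overtake.
Local Open Scope nat_scope.
Variable chi : 'I_n * 'I_n -> 'I_n -> bool.

(** Here [chi a i] says that an arc starting at i lies as required with respect to
    a. An open point counts as the start of an arc that ends after all others: its
    arc is still to come, and will end beyond the points reached so far. *)
Definition overtakes (s : config) :=
  \sum_(a in arcs s.1) (\sum_(b in arcs s.1) (chi a b.1 && (a.2 < b.2)) +
                        \sum_(i in s.2) chi a i).

(** The pairs that involve an old arc a are counted alike before and after: the
    arc (c, m) ends after a, just as the open point c was assumed to. Only the
    pairs of the new arc with the points that remain open are added. *)
Lemma overtakes_step m c b P M :
    open_partition m (P, M) -> valid_choice m M (c, b) ->
    {in arcs P, forall a, chi a m = false} ->
    chi (c, m) c = false -> chi (c, m) m = false ->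
  overtakes (step m (P, M) (c, b)) =
  overtakes (P, M) + (if c == m then 0 else \sum_(i in M) chi (c, m) i).
Proof.
move=> Ps cb chi_m chi_c chi_cm; have [Pm Mm _ _] := open_partitionP _ _ _ Ps.
have mM := m_notin_M Ps; have mMc : m \notin M :\ c by rewrite !inE (negPf mM) andbF.
rewrite /overtakes /= (arcs_glue Ps cb) (choice_lt Ps cb).
have sumM' a : chi a m = false ->
    \sum_(i in (if b then m |: M :\ c else M :\ c)) chi a i = \sum_(i in M :\ c) chi a i.
  by move=> am; case: b {cb} => //; rewrite big_setU1 //= am.
have [cm|cm] /= := eqVneq c m.
  rewrite addn0; apply: eq_bigr => a aP; congr addn.
  by rewrite sumM' ?chi_m // cm setD1_id.
have cM : c \in M by move: cb; rewrite /valid_choice /= (negPf cm).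
have lt_m a : a \in arcs P -> (a.2 < m) by move=> /(arcs_below Pm)/andP[].
have cmP : (c, m) \notin arcs P by apply/negP => /lt_m; rewrite /= ltnn.
rewrite big_setU1 //= addnC; congr addn.
  apply: eq_bigr => a aP; rewrite big_setU1 //= lt_m // andbT sumM' ?chi_m //.
  by rewrite (big_setD1 c cM) addnCA addnA.
rewrite big_setU1 //= ltnn andbF add0n sumM' // (big_setD1 c cM) /= chi_c add0n.
rewrite big1 ?add0n // => a /lt_m am.
by rewrite [m < _]ltnNge (ltnW am) andbF.
Qed.

End Overtake.

(** An arc that starts under a and ends after a crosses it. *)
Definition crossings :=
  overtakes (fun a i => (a.1 < i < a.2)%N).

(** An arc that starts before a and ends after a encloses it. *)
Definition nestings :=
  overtakes (fun a i => (i < a.1)%N).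

Lemma rc_crossings P : rc P = crossings (P, set0).
Proof.
rewrite /rc /crossings /overtakes -sum1_card.
under [RHS]eq_bigr do rewrite big_set0 addn0.
rewrite pair_big /= big_mkcond [RHS]big_mkcond /=; apply: eq_bigr => p _.
case: p => a b; rewrite in_set in_setX /=.
by case: (_ && (_ \in arcs P)) => //=; case: (_ && _).
Qed.

Lemma rarc_nestings P : rarc P = nestings (P, set0).
Proof.
rewrite /rarc /nestings /overtakes -sum1_card.
under [RHS]eq_bigr do rewrite big_set0 addn0.
rewrite exchange_big pair_big /= big_mkcond [RHS]big_mkcond /=.
apply: eq_bigr => p _; case: p => a b; rewrite in_set in_setX /=.
have [bP|_] := boolP (b \in arcs P); last by rewrite !andbF.
by have /arcsP[-> _] := bP; case: (a \in arcs P); rewrite //= andbT; case: (_ && _).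
Qed.

End OpenPartitions.

Arguments below {n} k.

Local Open Scope ring_scope.
Local Open Scope complex_scope.

Lemma big_valid_choice n (V : nmodType) (m : 'I_n) (M : {set 'I_n}) (G : _ -> V) :
    m \notin M ->
  \sum_(e | valid_choice m M e) G e =
  G (m, true) + \sum_(c in M) (G (c, false) + G (c, true)).
Proof.
move=> mM; rewrite (bigD1 (m, true)) /=; last by rewrite /valid_choice /= eqxx.
have E c : G (c, false) + G (c, true) = \sum_(b : bool) G (c, b).
  by rewrite big_bool addrC.
congr (_ + _); under [RHS]eq_bigr do rewrite E.
rewrite pair_big_dep; apply: eq_big => [[c b]|[c b] _] //=.
rewrite andbT /valid_choice xpair_eqE /=; case: eqVneq => [->|_]; last by rewrite andbT.
by rewrite (negPf mM) eqb_id andbN.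
Qed.

(** * Linear algebra of the Fock space *)

Lemma linear_at0 (K : pzRingType) (U V : lmodType K) (f : U -> V) :
  linear f -> f 0 = 0.
Proof.
move=> lf; have := lf 1 0 0; rewrite !scale1r addr0 => E.
by apply: (addIr (f 0)); rewrite -E add0r.
Qed.

Lemma linear_comb (K : pzRingType) (U V : lmodType K) (f : U -> V)
    (I : finType) (A : pred I) (a : I -> K) (u : I -> U) : linear f ->
  f (\sum_(s | A s) a s *: u s) = \sum_(s | A s) a s *: f (u s).
Proof.
move=> lf; elim/big_rec2: _ => [|s u' v' _ <-]; first exact: linear_at0.
exact: lf.
Qed.

(** This makes it possible to compute the image of a linear extension to the
    tensor algebra under a linear form without knowing that the extended
    function is multilinear. *)
Lemma fglift_comp (K : fieldType) (V U W : lmodType K) (f : seq V -> U) (g : U -> W)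
    (z : {freeg (seq V) / K}) : linear g -> g (fglift f z) = fglift (g \o f) z.
Proof.
move=> lg; have g0 := linear_at0 lg.
have fg0 (M : lmodType K) (h : seq V -> M) : fglift h 0 = 0.
  by rewrite -(subrr 0) lift_is_additive subrr.
elim/freeg_rect_dom0: z => [|k w z _ _ IH]; first by rewrite !fg0 g0.
by rewrite -[<< k *g w >>]scale1r !fglift_linear lg IH !liftU -[k *: f w]addr0 lg g0 addr0.
Qed.

Section Expansion.
Variables (R : realType) (HR : completeNormedModType R) (ip : {dot HR for idfun}).
Variables (T : HR -> {linear cplx HR -> cplx HR}) (q t : R).

Local Notation H := (cplx HR).
Local Notation fock := (tensor_alg (H : lmodType R[i])).

Lemma annihilation_linear y : linear (annihilation ip q t y : fock -> fock).
Proof.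
apply: tensor_ext_linear; apply: qt_sum_multilinear => [w' a u v|z s s' a u v].
  by rewrite cip_linear scalerDl scalerA.
by rewrite tens_multilinear scalerDr !scalerA [_ * a]mulrC.
Qed.

Lemma creation_linear (y : H) : linear (creation y : fock -> fock).
Proof.
by apply: tensor_ext_linear => s s' a u v; rewrite !rcons_cat /= tens_multilinear.
Qed.

Lemma gauge_linear (S : {linear H -> H}) : linear (gauge q t S : fock -> fock).
Proof.
apply: tensor_ext_linear; apply: qt_sum_multilinear => [w' a u v|z s s' a u v].
  by rewrite linearP -!cats1 tens_multilinear.
by rewrite !rcons_cat /= tens_multilinear.
Qed.

Lemma Yop_linear y : linear (Yop ip q t T y).
Proof.
move=> a u v; rewrite /Yop annihilation_linear creation_linear gauge_linear.
rewrite !scalerDr [X in X + _ = _]addrACA; exact: addrACA.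
Qed.

(** The exponents of t and q count the letters to the left and to the right of
    the omitted one. If the letters are indexed increasingly by M, these are the
    elements of M below and above its index. *)
Lemma qt_sum_enum n (phi : H -> seq H -> fock) (f : 'I_n -> H) (M : {set 'I_n}) :
  qt_sum q t phi [seq f i | i <- enum M] =
  \sum_(c in M) ((t ^+ (\sum_(i in M) (i < c)%N) *
                  q ^+ (\sum_(i in M) (c < i)%N))%:C : R[i]) *:
    phi (f c) [seq f i | i <- enum (M :\ c)].
Proof.
rewrite /qt_sum size_map -cardE (big_enum_val (A := mem M)) /=; apply: eq_bigr => k _.
set c := enum_val k; have sk : (k < size (enum M))%N by rewrite -cardE.
have nthc d : nth d (enum M) k = c by rewrite -enum_val_nth.
have -> : nth 0 [seq f i | i <- enum M] k = f c.
  by rewrite (@nth_map _ c _ 0 f k (enum M) sk) nthc.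
rewrite -map_take -map_drop -map_cat.
have E : enum M = take k (enum M) ++ c :: drop k.+1 (enum M).
  by rewrite -{1}(nthc c) -drop_nth // cat_take_drop.
have [lt1 lt2] : all (fun i : 'I_n => i < c)%N (take k (enum M)) /\
    all (fun i : 'I_n => c < i)%N (drop k.+1 (enum M)).
  have := enum_block_sorted M; rewrite (sorted_pairwise ltn_trans) {1}E map_cat.
  rewrite pairwise_cat /= allrel_consr !all_map => /and3P[/andP[lt1 _] _].
  by case/andP => lt2 _; split; [exact: lt1|exact: lt2].
have card (p : pred 'I_n) : (\sum_(i in M) p i)%N = count p (enum M).
  by rewrite -big_enum /= -sum1_count [RHS]big_mkcond; apply: eq_bigr => i _; case: (p i).
have notgt : {in take k (enum M), forall i : 'I_n, (c < i)%N = false}.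
  by move=> i /(allP lt1) /= ic; rewrite ltnNge ltnW.
have notlt : {in drop k.+1 (enum M), forall i : 'I_n, (i < c)%N = false}.
  by move=> i /(allP lt2) /= ic; rewrite ltnNge ltnW.
have -> : (\sum_(i in M) (i < c)%N)%N = k.
  rewrite (card (fun i : 'I_n => i < c)%N) {1}E count_cat /= ltnn.
  move: lt1; rewrite all_count => /eqP->.
  rewrite (eq_in_count notlt) count_pred0 !addn0 size_takel //; exact: ltnW.
have -> : (\sum_(i in M) (c < i)%N)%N = (#|M| - k.+1)%N.
  rewrite (card (fun i : 'I_n => c < i)%N) {1}E count_cat /= ltnn.
  move: lt2; rewrite all_count => /eqP->.
  by rewrite (eq_in_count notgt) count_pred0 !add0n size_drop -cardE.
have -> // : enum (M :\ c) = take k (enum M) ++ drop k.+1 (enum M).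
  rewrite enum_setD1 {1}E filter_cat /= eqxx /=; congr (_ ++ _).
    by apply/all_filterP/allP => i /(allP lt1); rewrite -val_eqE neq_ltn => ->.
  by apply/all_filterP/allP => i /(allP lt2); rewrite -val_eqE neq_ltn orbC => ->.
Qed.

(** * The expansion of the product of operators *)

Variables (n : nat) (x : n.-tuple HR).
Local Notation config := ({set {set 'I_n}} * {set 'I_n})%type.
Implicit Types (m c : 'I_n) (B M : {set 'I_n}) (P : {set {set 'I_n}}).

(** The letter carried by a block, as long as it is open: the vector paired with
    x_{max B} in [block_weight] is the one of B deprived of its maximum. *)
Definition block_vector B : H :=
  if [seq tnth x i | i <- enum B] is y :: s then
    foldl (fun v z => T z v) (of_real y) s
  else 0.

Lemma block_vector_set1 m : block_vector [set m] = of_real (tnth x m).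
Proof. by rewrite /block_vector enum_set1. Qed.

Lemma block_vector_setU1 m B : B \subset below m -> B != set0 ->
  block_vector (m |: B) = T (tnth x m) (block_vector B).
Proof.
rewrite -card_gt0 cardE /block_vector => Bm; rewrite (enum_setU1_max Bm) map_rcons.
by case: (enum B) => //= i s _; rewrite foldl_rcons.
Qed.

Lemma block_weight_setU1 m B : B \subset below m -> B != set0 ->
  block_weight ip T x (m |: B) = cip ip (of_real (tnth x m)) (block_vector B).
Proof.
rewrite -card_gt0 cardE /block_vector /block_weight => Bm.
rewrite (enum_setU1_max Bm) map_rcons.
by case: (enum B) => //= i s _; rewrite last_rcons belast_rcons.
Qed.

(** Only closed blocks contribute their scalar product, and a pair of arcs
    contributes its factor as soon as one of the two has ended. *)
Definition open_weight (s : config) : R[i] :=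
  (q ^+ crossings s * t ^+ nestings s)%:C *
  \prod_(B in s.1 | [disjoint B & s.2]) block_weight ip T x B.

Definition open_word (s : config) : seq H :=
  [seq block_vector (pblock s.1 i) | i <- enum s.2].

Section Step.
Variables (m : 'I_n) (P : {set {set 'I_n}}) (M : {set 'I_n}) (c : 'I_n) (b : bool).
Hypotheses (Ps : open_partition m (P, M)) (cb : valid_choice m M (c, b)).

(** The block of c, if there is one, was open; the block that m joins or forms is
    closed precisely when b is false; the status of the other blocks does not
    change. *)
Lemma prod_closed_step :
  \prod_(B in (step m (P, M) (c, b)).1 | [disjoint B & (step m (P, M) (c, b)).2])
     block_weight ip T x B =
  (if b then 1 else cip ip (of_real (tnth x m)) (block_vector (pblock P c))) *
  \prod_(B in P | [disjoint B & M]) block_weight ip T x B.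
Proof.
have [Pm Mm _ _] := open_partitionP _ _ _ Ps.
have mP := m_notin_block Ps; have mM := m_notin_M Ps.
have newP : m |: pblock P c \notin P :\ pblock P c.
  by rewrite !inE negb_and; apply/orP; right; apply/negP => /mP; rewrite setU11.
rewrite /= big_mkcondr /glue big_setU1 //=; congr (_ * _).
  case: b cb => cb'.
    by rewrite ifF //; apply/negPf/pred0Pn; exists m; rewrite /= !setU11.
  have cm : c != m by move: cb'; rewrite /valid_choice /=; case: eqVneq.
  have cB : c \in pblock P c by rewrite (choice_pblock c Ps) (choice_lt Ps cb').
  rewrite ifT; last first.
    rewrite -setI_eq0; apply/eqP/setP => i; rewrite in_setI in_setU1 in_set0.
    apply/negPf/negP => /andP[/orP[/eqP->|iB] iM].
      by rewrite in_setD1 (negPf mM) andbF in iM.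
    by move: (open_notin_block Ps cb' iM); rewrite iB.
  apply: block_weight_setU1; first exact: pblock_subset.
  by apply/set0Pn; exists c.
rewrite [RHS]big_mkcondr /= [LHS]big_mkcond [RHS]big_mkcond /=.
apply: eq_bigr => B _; rewrite in_setD1.
have [BP|] := boolP (B \in P); last by rewrite andbF.
rewrite andbT; case: eqVneq => [BE|Bc] /=.
  rewrite ifF //; apply/negPf/pred0Pn; exists c; rewrite /= BE.
  have [cm|cm] := eqVneq c m.
    by move: BP; rewrite BE (pblock_out Pm) ?(partition0 Pm) // cm.
  rewrite (choice_pblock c Ps) (choice_lt Ps cb) cm /=.
  by move: cb; rewrite /valid_choice /= (negPf cm).
have -> // : [disjoint B & if b then m |: M :\ c else M :\ c] = [disjoint B & M].
have cB : c \notin B.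
  by apply: contra Bc => cB; rewrite (def_pblock (partition_trivIset Pm) BP cB).
rewrite -!setI_eq0; congr (_ == _); apply/setP => i; rewrite !in_setI.
have [iB|//] := boolP (i \in B).
have im : i != m by apply: contraNneq (mP B BP) => <-.
have ic : i != c by apply: contraNneq cB => <-.
by case: b; rewrite ?in_setU1 in_setD1 ?(negPf im) ic.
Qed.

(** If c is not m, the factor t^i q^j is the one by which [qt_sum] weights the letter of c. *)
Lemma open_weight_step : open_weight (step m (P, M) (c, b)) =
  (if c == m then 1 else
     (t ^+ (\sum_(i in M) (i < c)%N) * q ^+ (\sum_(i in M) (c < i)%N))%:C *
     (if b then 1 else cip ip (of_real (tnth x m)) (block_vector (pblock P c)))) *
  open_weight (P, M).
Proof.
have [Pm /subsetP Mm _ _] := open_partitionP _ _ _ Ps.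
have lt_m a : a \in arcs P -> (a.1 < a.2 < m)%N by apply: arcs_below.
have cm := choice_le Ps cb.
rewrite /open_weight prod_closed_step /=.
rewrite /crossings /nestings !(overtakes_step Ps cb) ?ltnn ?andbF //; first last.
- by move=> a /lt_m /andP[_ am]; rewrite [(m < _)%N]ltnNge (ltnW am) andbF.
- by rewrite ltnNge cm.
- by move=> a /lt_m /andP[a1 a2]; rewrite ltnNge ltnW // (ltn_trans a1).
case: eqVneq => [cE|cNm].
  have -> : b = true by move: cb; rewrite /valid_choice /= cE eqxx.
  by rewrite !addn0 !mul1r.
have -> : (\sum_(i in M) (c < i < m) = \sum_(i in M) (c < i))%N.
  by apply: eq_bigr => i /Mm; rewrite in_below => ->; rewrite andbT.
rewrite !exprD [in LHS]mulrACA [X in X%:C * _]mulrC [X in (X * _)%:C]mulrC.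
by rewrite rmorphM mulrACA.
Qed.

Lemma open_word_step : open_word (step m (P, M) (c, b)) =
  let w := [seq block_vector (pblock P i) | i <- enum (M :\ c)] in
  if b then rcons w (if c == m then of_real (tnth x m)
                     else T (tnth x m) (block_vector (pblock P c)))
  else w.
Proof.
have [Pm Mm _ _] := open_partitionP _ _ _ Ps.
have wE : [seq block_vector (pblock (glue m c P) i) | i <- enum (M :\ c)] =
    [seq block_vector (pblock P i) | i <- enum (M :\ c)].
  apply/eq_in_map => i; rewrite mem_enum => iM.
  by rewrite (pblock_step_open Ps cb).
rewrite /open_word /=; case: b cb => cb' //.
rewrite enum_setU1_max; last by apply: subset_trans Mm; apply: subD1set.
rewrite map_rcons wE (pblock_glue c Pm); congr rcons.
have [->|cm] := eqVneq c m.
  by rewrite (pblock_out Pm) // setU0 block_vector_set1.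
apply: block_vector_setU1; first exact: pblock_subset.
by apply/set0Pn; exists c; rewrite (choice_pblock c Ps) (choice_lt Ps cb').
Qed.

End Step.

(** The three kinds of choices match the three summands of the operator:
    creation is (m, true), while for c in M the choice (c, false) is
    annihilation and (c, true) is the gauge operator at the letter of c. *)
Lemma Yop_open_word m P M : open_partition m (P, M) ->
  open_weight (P, M) *: Yop ip q t T (tnth x m) (tens (open_word (P, M))) =
  \sum_(e | valid_choice m M e)
     open_weight (step m (P, M) e) *: tens (open_word (step m (P, M) e)).
Proof.
move=> Ps; have mM := m_notin_M Ps.
have v_m : valid_choice m M (m, true) by rewrite /valid_choice /= eqxx.
have neq_m c : c \in M -> (c == m) = false.
  by move=> cM; have [cm|//] := eqVneq c m; move: mM; rewrite -cm cM.
have v_c c b : c \in M -> valid_choice m M (c, b).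
  by move=> cM; rewrite /valid_choice /= neq_m.
rewrite big_valid_choice // (open_weight_step Ps v_m) (open_word_step Ps v_m).
rewrite eqxx mul1r setD1_id //= /Yop annihilationE creationE gaugeE.
rewrite !qt_sum_enum addrAC -big_split /= addrC scalerDr scaler_sumr.
congr (_ + _); apply: eq_bigr => c cM.
rewrite !(open_weight_step Ps (v_c _ _ cM)) !(open_word_step Ps (v_c _ _ cM)).
rewrite neq_m // mulr1 scalerDr !scalerA /=.
congr (_ *: _ + _ *: _); last exact: mulrC.
by rewrite -mulrA; apply: mulrC.
Qed.

Lemma foldl_Yop_vacuum k : (k <= n)%N ->
  foldl (fun X y => Yop ip q t T y \o X) idfun (take k x) (vacuum HR) =
  \sum_(s | @open_partition n k s) open_weight s *: tens (open_word s).
Proof.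
elim: k => [_|k IH kn].
  have below0 : below 0 = set0 :> {set 'I_n} by apply/setP => i; rewrite !inE.
  rewrite take0 (big_pred1 (set0, set0)) => [|[P M]].
    have arcs0 : arcs (set0 : {set {set 'I_n}}) = set0.
      apply/setP => p; rewrite [RHS]inE; apply/negP => /arcsP[_ [B []]].
      by rewrite inE.
    rewrite /open_weight /open_word /crossings /nestings /overtakes /= arcs0.
    by rewrite enum_set0 !big_set0 big_pred0 ?mulr1 ?scale1r // => B; rewrite inE.
  apply/open_partitionP/idP.
    by rewrite below0 partition_set0 subset0 => -[/eqP-> /eqP-> _ _]; apply: eqxx.
  rewrite /= xpair_eqE => /andP[/eqP-> /eqP->].
  by rewrite below0 partition_set0; split=> // i; rewrite inE.
pose m := Ordinal kn.
rewrite (take_nth 0) ?size_tuple // foldl_rcons /= {}IH ?(ltnW kn) //.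
have -> : nth 0 x k = tnth x m by rewrite (tnth_nth 0).
rewrite (linear_comb _ _ _ (Yop_linear _)) (big_step m); apply: eq_bigr => -[P M] Ps.
exact: Yop_open_word.
Qed.

Lemma word_ip_nil (w : seq H) : word_ip ip [::] w = (w == [::])%:R.
Proof. by rewrite /word_ip; case: w => //=; rewrite big_ord0. Qed.

(** The symmetrizer preserves the length of words, and it is the identity on the
    empty word. *)
Lemma symmetrizer_word_vacuum (w : seq H) :
  ip00 ip (vacuum HR) (symmetrizer_word q t w) = (w == [::])%:R.
Proof.
rewrite /symmetrizer_word -[_ *: _]addr0 ip00_linear.
rewrite (linear_comb _ _ _ (ip00_linear ip _)).
rewrite (linear_at0 (ip00_linear ip _)) addr0.
under eq_bigr => s _ do
  rewrite ip00_tens word_ip_nil -size_eq0 size_map size_enum_ord.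
rewrite size_eq0; case: w => [|y w] /=; last first.
  by rewrite big1 ?scaler0 // => s _; rewrite scaler0.
rewrite (big_pred1 (1%g : 'S_0)) => [|s]; last by apply/esym/eqP/permP => -[].
rewrite (_ : inversions _ = 0%N); last by apply: eq_card0 => -[[]].
by rewrite !expr0 !scale1r.
Qed.

(** The linear form is the linear extension of the indicator of the empty word,
    which is multilinear as it vanishes on all words with a letter. *)
Lemma ipqt_vacuum_comb (I : finType) (A : pred I) (a : I -> R[i]) (w : I -> seq H) :
  ipqt ip q t (vacuum HR) (\sum_(s | A s) a s *: tens (w s)) =
  \sum_(s | A s && (w s == [::])) a s.
Proof.
pose g (w : seq H) : R[i]^o := (w == [::])%:R.
have mg : multilinear g.
  by move=> s s' b u v; rewrite /g; case: s => *; rewrite scaler0 addr0.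
have E u : ipqt ip q t (vacuum HR) u = tensor_ext g u.
  rewrite /ipqt /symmetrizer /tensor_ext (fglift_comp _ _ (ip00_linear ip _)).
  by congr (fglift _ _); apply/funext => v; rewrite /= symmetrizer_word_vacuum.
rewrite E (linear_comb _ _ _ (tensor_ext_linear mg)) big_mkcondr.
apply: eq_bigr => s _; rewrite (tensor_extE mg) /g.
by case: eqP => _; rewrite ?scaler0 // -[_ *: _]/(_ * _) mulr1.
Qed.

(** Without open blocks, the condition on closed blocks applies to all. *)
Lemma open_partition_ge2 P : @open_partition n n (P, set0) = partition_ge2 P.
Proof.
have T_n : below n = [set: 'I_n] by apply/setP => i; rewrite !inE ltn_ord.
apply/open_partitionP/andP; rewrite T_n => -[Pn].
  move=> _ _ H; split=> //; apply/forall_inP => B /H.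
  by rewrite -setI_eq0 setI0 eqxx orbF.
move=> /forall_inP H; split=> // [i|B /H -> //].
by rewrite inE.
Qed.

End Expansion.

Theorem theorem4 (R : realType) (HR : completeNormedModType R)
    (ip : {dot HR for idfun}) (ip_norm : forall v : HR, ip v v = `|v| ^+ 2)
    (HR_separable : separable HR)
    (T : HR -> {linear cplx HR -> cplx HR})
    (T_bounded : forall v : HR, bounded_op ip (T v))
    (T_selfadjoint : forall v : HR, selfadjoint_op ip (T v))
    (q t : R) (hq : -1 < q < 1) (ht : `|q| < t < 1)
    (n : nat) (hn : (1 <= n)%N) (x : n.-tuple HR) :
  (* the composite Y(x_n) \o ... \o Y(x_1) *)
  vacuum_state ip q t (foldl (fun X y => Yop ip q t T y \o X) idfun x) =
  \sum_(P : {set {set 'I_n}} | partition_ge2 P)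
     (q ^+ rc P * t ^+ rarc P)%:C * \prod_(B in P) block_weight ip T x B.
Proof.
rewrite /vacuum_state.
have := foldl_Yop_vacuum ip T q t x (leqnn n); rewrite take_oversize ?size_tuple // => ->.
rewrite ipqt_vacuum_comb.
rewrite (reindex_onto (fun P => (P, set0)) fst) /=; last first.
  move=> [P M] /andP[_]; rewrite -size_eq0 size_map -cardE cards_eq0 /=.
  by move=> /eqP ->.
apply: eq_big => P; first by rewrite open_partition_ge2 /open_word enum_set0 !eqxx !andbT.
rewrite open_partition_ge2 => _; rewrite /open_weight /= -rc_crossings -rarc_nestings.
congr (_ * _); apply: eq_bigl => B.
by rewrite -setI_eq0 setI0 eqxx andbT.
Qed.
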